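(* For every $s\in\mathbb{N}$, $$\lim_{n\to +\infty}\log_n\bigl(\operatorname{rk}(q_n^s)\bigr)=\lim_{n\to +\infty}\log_n\bigl(\operatorname{brk}(q_n^s)\bigr)=s.$$
   Context: Here $n,s$ are positive integers, $\log_n$ is the logarithm in base $n$, and $q_n=x_1^2+\cdots+x_n^2\in\mathbb{C}[x_1,\dots,x_n]$. For a homogeneous polynomial $f\in\mathbb{C}[x_1,\dots,x_n]$ of degree $d$, the (Waring) rank $\operatorname{rk} f$ is the smallest natural number $r$ such that $f=\sum_{j=1}^r l_j^d$ for some linear forms $l_1,\dots,l_r\in\mathbb{C}[x_1,\dots,x_n]$. The border rank $\operatorname{brk} f$ is the smallest natural number $r$ such that $f$ lies in the Zariski closure of the set of homogeneous polynomials of degree $d$ in $\mathbb{C}[x_1,\dots,x_n]$ having rank at most $r$. *)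

(* Defs.v *)
From mathcomp Require Import all_boot all_order all_algebra.
From mathcomp Require Import boolp classical_sets reals exp mpoly.

Set Implicit Arguments.
Unset Strict Implicit.
Unset Printing Implicit Defensive.

Import GRing.Theory.

Local Open Scope ring_scope.
Local Open Scope classical_set_scope.

Section ZariskiTopology.
Variables (K : fieldType) (N : nat).

Definition zero_locus (I : set {mpoly K[N]}) : set ('I_N -> K) :=
  [set v | forall p, I p -> p.@[v] = 0].

Definition zariski_closed (Z : set ('I_N -> K)) : Prop :=
  exists I : set {mpoly K[N]}, Z = zero_locus I.

Definition zariski_closure (A : set ('I_N -> K)) : set ('I_N -> K) :=
  smallest zariski_closed A.

End ZariskiTopology.

Definition is_least (P : set nat) (r : nat) : Prop :=
  P r /\ forall k, P k -> (r <= k)%N.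

Section WaringRank.
Variables (K : fieldType) (n d : nat).

Definition sum_of_powers (f : {mpoly K[n]}) (r : nat) : Prop :=
  exists l : 'I_r -> {mpoly K[n]},
    (forall j, l j \is 1.-homog) /\ f = \sum_(j < r) l j ^+ d.

(* [d] is the degree of [f]; it is a parameter because the zero form has no
   well-defined degree. *)
Definition is_rank (f : {mpoly K[n]}) : set nat :=
  is_least (sum_of_powers f).

(* The default value 0 is only returned when the set is empty. *)
Definition rk (f : {mpoly K[n]}) : nat := xget 0%N (is_rank f).

(* The forms of degree [d] make up an affine space, with one coordinate for each
   monomial of degree [d]. *)
Definition monomial_deg : finType := {m : 'X_{1..n < d.+1} | mdeg m == d}.

Definition form_coord (f : {mpoly K[n]}) : 'I_#|monomial_deg| -> K :=
  fun i => f@_(val (enum_val i)).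

Definition forms_rank_le (r : nat) : set {mpoly K[n]} :=
  [set g | g \is d.-homog /\ exists2 k, (k <= r)%N & is_rank g k].

Definition in_closure_rank_le (f : {mpoly K[n]}) (r : nat) : Prop :=
  f \is d.-homog /\
  zariski_closure (form_coord @` forms_rank_le r) (form_coord f).

Definition is_border_rank (f : {mpoly K[n]}) : set nat :=
  is_least (in_closure_rank_le f).

Definition brk (f : {mpoly K[n]}) : nat := xget 0%N (is_border_rank f).

End WaringRank.

Definition quadric (K : fieldType) (n : nat) : {mpoly K[n]} :=
  \sum_(i < n) 'X_i ^+ 2.

Definition logb (R : realType) (b x : R) : R := ln x / ln b.

(* Main.v *)
Require Import Defs.
From mathcomp Require Import all_boot all_order all_algebra.
From mathcomp Require Import mpoly complex.
From mathcomp Require Import classical_sets reals topology normedtype sequences.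
From mathcomp Require Import boolp exp.

Import Order.TTheory GRing.Theory Num.Theory.
Import numFieldNormedType.Exports.

(** Both ranks of [q_n ^ s] are squeezed between two constants times [n ^ s],
    the constants depending on [s] only; after taking [log_n] the constants
    contribute a bounded multiple of [1 / ln n] and disappear.

    Upper bound ([quadric_exp_sum_of_powers]).  Expanding [q_n ^ s] gives
    [n ^ s] products [x_{f 1} ^ 2 ... x_{f s} ^ 2], one for each [f] from
    [{1..s}] to [{1..n}].  Each is a product of [2 s] linear forms, hence by
    polarization a combination of [2 ^ (2 s)] powers of linear forms of degree
    [2 s], and over an algebraically closed field the coefficients are absorbed
    in the linear forms.  So the rank is at most [2 ^ (2 s) * n ^ s].

    Lower bound ([border_rank_quadric_exp]).  With a form [g] of degree [2 s]
    associate the matrix whose entry at two monomials [m], [m'] of degree [s] is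
    the coefficient of [m m'] in [g], divided by the multinomial coefficient.  A
    power of a linear form gives a matrix of rank at most one, so the rank of
    the matrix is at most the Waring rank of [g]; vanishing of its minors is a
    Zariski closed condition, so the bound extends to the border rank
    ([border_rank_catalecticant]).  It is enough to use the minor indexed by the
    squarefree monomials [x_A], with [A] a set of [s] variables: only even
    exponents occur in [q_n ^ s], and [x_A x_B] has even exponents just when
    [A = B], so the minor is diagonal with nonzero diagonal.  Hence the border
    rank is at least ['C(n, s)], and [n ^ s <= 2 ^ s * s! * 'C(n, s)] as soon as
    [2 s <= n]. *)

Set Implicit Arguments.
Unset Strict Implicit.
Unset Printing Implicit Defensive.

Local Open Scope ring_scope.

(** * Polarization of a product *)

Section Polarization.
Variables (R : comNzRingType) (I : finType).

(** Inclusion-exclusion: the sum is the expansion of a product over [i] whose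
    factor is [1] for [i] in [B] and [1 - 1] otherwise. *)
Lemma sum_signed_supersets (B : {set I}) :
  \sum_(S : {set I}) (-1) ^+ #|~: S| * (B \subset S)%:R
    = (B == [set: I])%:R :> R.
Proof.
transitivity (\prod_i (1 + (if i \in B then 0 else -1)) : R).
  rewrite bigA_distr; apply: eq_bigr => S _.
  rewrite (bigID (mem S)) /= big1 ?mul1r => [|i ->//].
  rewrite (eq_bigr (fun i => if i \in B then 0 else -1)) => [|i /negbTE ->//].
  have [BS|/fintype.subsetPn[i iB iS]] := boolP (B \subset S).
    rewrite mulr1 -prodr_const.
    apply: eq_big => [i|i /[!inE]]; first by rewrite inE.
    by case: ifP => // /(fintype.subsetP BS) ->.
  by rewrite mulr0 (bigD1 i) //= iB mul0r.
have [->|] := eqVneq B [set: I].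
  by rewrite big1 // => i _; rewrite inE addr0.
rewrite -finset.subTset => /fintype.subsetPn[i _ /negbTE iB].
by rewrite (bigD1 i) //= iB subrr mul0r.
Qed.

(** Expanding the powers, the monomial attached to a map [f : I -> I] occurs for
    all [S] containing the image of [f]; its signs cancel unless [f] is onto, that
    is, a permutation, and each of the [#|I|!] permutations gives the product. *)
Lemma polarization (x : I -> R) :
  \sum_(S : {set I}) (-1) ^+ #|~: S| * (\sum_(i in S) x i) ^+ #|I|
    = ((#|I|)`!)%:R * \prod_i x i.
Proof.
pose c (f : {ffun I -> I}) := \prod_i x (f i).
transitivity (\sum_(f : {ffun I -> I}) c f * (injectiveb f)%:R); last first.
  rewrite (eq_bigr (fun f : {ffun I -> I} => (injectiveb f)%:R * \prod_i x i)).
    rewrite -mulr_suml -natr_sum -big_mkcond /= sum1dep_card -ffactnn.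
    by rewrite -card_inj_ffuns cardsE.
  move=> f _; rewrite mulrC; case: injectiveP => [injf|]; last by rewrite !mul0r.
  congr (_ * _); rewrite [RHS](reindex f) //.
  by apply: onW_bij; apply: injF_bij.
transitivity (\sum_(S : {set I}) \sum_(f : {ffun I -> I})
   c f * ((-1) ^+ #|~: S| * (f @: [set: I] \subset S)%:R)).
  apply: eq_bigr => S _; rewrite big_mkcond -(prodr_const I) bigA_distr_bigA /=.
  rewrite mulr_sumr; apply: eq_bigr => f _.
  rewrite mulrCA; congr (_ * _).
  have [fS|/fintype.subsetPn[_ /imsetP[i _ ->] fiS]] := boolP (_ \subset S).
    rewrite mulr1; apply: eq_bigr => i _.
    by rewrite (fintype.subsetP fS) ?imset_f.
  by rewrite mulr0 (bigD1 i) //= (negbTE fiS) mul0r.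
rewrite exchange_big /=; apply: eq_bigr => f _.
rewrite -mulr_sumr sum_signed_supersets; congr (_ * _%:R).
congr nat_of_bool; rewrite eqEcard finset.subsetT /=.
apply/idP/injectiveP => [le|injf]; last by rewrite card_imset.
have /imset_injP inj : #|f @: [set: I]| == #|[set: I]|.
  by rewrite eqn_leq le leq_imset_card.
by move=> i j; apply: inj; rewrite inE.
Qed.

End Polarization.

(** * Coefficients of powers of linear and quadratic forms *)

Lemma mnm_sum_of_variables n d (m : 'X_{1..n}) : mdeg m = d ->
  exists f : 'I_d -> 'I_n, m = (\sum_k U_(f k))%MM.
Proof.
pose t := flatten [seq nseq (m i) i | i <- enum 'I_n].
have mE : m = (\sum_(i <- t) U_(i))%MM.
  rewrite [LHS]multinomUE_id big_flatten big_map big_enum /=.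
  apply: eq_bigr => i _; rewrite big_nseq.
  by elim: (m i) => [|k IH]; rewrite ?mulm0n // mulmS IH.
have st : size t = mdeg m.
  rewrite [X in mdeg X]mE mdeg_sum (eq_bigr (fun=> 1%N)) => [|i _].
    by rewrite sum1_size.
  exact: mdeg1.
move=> <-; rewrite -st; exists (tnth (in_tuple t)); rewrite mE.
by rewrite [LHS](big_tnth _ _ t).
Qed.

(** For [m] of degree [d] this is the multinomial coefficient [d! / m!].  Counting
    the maps with fibre sizes [m] makes it appear directly in the expansion of a
    [d]-th power, and its positivity just says that such a map exists. *)
Definition multinomial n d (m : 'X_{1..n}) :=
  #|[pred f : {ffun 'I_d -> 'I_n} | (\sum_k U_(f k))%MM == m]|.

Lemma multinomial_neq0 (K : numFieldType) n d (m : 'X_{1..n}) :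
  mdeg m = d -> (multinomial d m)%:R != 0 :> K.
Proof.
move=> /mnm_sum_of_variables[f mE]; rewrite pnatr_eq0 -lt0n.
apply/card_gt0P; exists (finfun f); rewrite inE mE; apply/eqP.
by apply: eq_bigr => k _; rewrite ffunE.
Qed.

Section PowersOfLinearCombinations.
Variables (R : comNzRingType) (n : nat).
Implicit Types m : 'X_{1..n}.

Lemma mcoeff_sum_exp d (w : 'I_n -> 'X_{1..n}) (a : 'I_n -> R) m :
  ((\sum_i a i *: 'X_[w i]) ^+ d)@_m
    = \sum_(f : {ffun 'I_d -> 'I_n} | (\sum_k w (f k))%MM == m) \prod_k a (f k).
Proof.
rewrite -[d in LHS]card_ord -prodr_const bigA_distr_bigA /= raddf_sum /=.
rewrite [RHS]big_mkcond; apply: eq_bigr => f _.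
rewrite scaler_prod mcoeffZ.
have -> : \prod_k 'X_[w (f k)] = 'X_[\sum_k w (f k)] :> {mpoly R[n]}.
  by rewrite (big_morph _ (@mpolyXD _ _) (@mpolyX0 _ _)).
by rewrite mcoeffX; case: eqP => _; rewrite ?mulr1 ?mulr0.
Qed.

Lemma linear_formE (l : {mpoly R[n]}) : l \is 1.-homog ->
  l = \sum_i l@_U_(i) *: 'X_i.
Proof.
move=> hl; apply/mpolyP => m; rewrite raddf_sum /=.
have [/mdeg1P[i /eqP ->]|m1] := boolP (mdeg m == 1%N).
  rewrite (bigD1 i) //= mcoeffZ mcoeffX eqxx mulr1 big1 ?addr0 // => j ji.
  by rewrite mcoeffZ mcoeffX eq_mnm1 (negbTE ji) mulr0.
rewrite (dhomog_nemf_coeff hl m1) big1 // => i _.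
rewrite mcoeffZ mcoeffX; case: eqP => [E|]; last by rewrite mulr0.
by rewrite -E mdeg1 in m1.
Qed.

(** The first factor is multiplicative in [m]; this is what makes the
    catalecticant of a power of a linear form have rank at most one. *)
Lemma mcoeff_linear_form_exp d (l : {mpoly R[n]}) m : l \is 1.-homog ->
  (l ^+ d)@_m = 'X_[m].@[fun i => l@_U_(i)] * (multinomial d m)%:R.
Proof.
move=> /linear_formE lE; rewrite [in LHS]lE mcoeff_sum_exp.
rewrite (eq_bigr (fun=> 'X_[m].@[fun i => l@_U_(i)])) => [|f /eqP <-].
  by rewrite sumr_const mulr_natr.
rewrite (big_morph _ (@mpolyXD _ _) (@mpolyX0 _ _)) rmorph_prod /=.
by apply: eq_bigr => k _; rewrite mevalXU.
Qed.

End PowersOfLinearCombinations.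

Lemma mcoeff_quadric_exp (K : fieldType) n s (m : 'X_{1..n}) :
  (quadric K n ^+ s)@_m
    = #|[pred f : {ffun 'I_s -> 'I_n} | (\sum_k U_(f k) *+ 2)%MM == m]|%:R.
Proof.
rewrite /quadric (eq_bigr (fun i => 1 *: 'X_[U_(i) *+ 2])) => [|i _].
  by rewrite mcoeff_sum_exp big1_eq sumr_const.
by rewrite scale1r mpolyXn.
Qed.

(** * Lower bound: a catalecticant minor *)

Section Catalecticant.
Variables (K : numFieldType) (n d N : nat) (w : 'I_N -> 'X_{1..n}).

(** A square submatrix of the classical catalecticant matrix of [g].  Up to the
    factor [d!], dividing by the multinomial coefficient turns the coefficient at
    [w i + w j] into the corresponding partial derivative of [g]. *)
Definition catalecticant (g : {mpoly K[n]}) : 'M[K]_N :=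
  \matrix_(i, j) (g@_(w i + w j) / (multinomial d (w i + w j)%MM)%:R).

Hypothesis deg_w : forall i j, mdeg (w i + w j)%MM = d.

(** A sum of [r] powers gives a product of an [N x r] by an [r x N] matrix, each
    holding the values of the monomials [w i] at the linear forms. *)
Lemma mxrank_catalecticant g r :
  sum_of_powers d g r -> (\rank (catalecticant g) <= r)%N.
Proof.
case=> l [hl ->].
pose v i j := 'X_[w i].@[fun k => (l j)@_U_(k)].
suff -> : catalecticant (\sum_(j < r) l j ^+ d)
    = (\matrix_(i, j) v i j) *m (\matrix_(j, i) v i j).
  exact: leq_trans (mxrankM_maxl _ _) (rank_leq_col _).
apply/matrixP => i i'; rewrite !mxE raddf_sum /= mulr_suml.
apply: eq_bigr => j _; rewrite !mxE mcoeff_linear_form_exp //.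
by rewrite mulfK ?multinomial_neq0 // mpolyXD mevalM.
Qed.

Lemma form_coord_monomial m : mdeg m = d ->
  exists i, forall g : {mpoly K[n]}, form_coord (d:=d) g i = g@_m.
Proof.
move=> md; have ltm : (mdeg m < d.+1)%N by rewrite md.
have dm : mdeg (BMultinom ltm) == d by rewrite /= md.
by exists (enum_rank (Sub (BMultinom ltm) dm : monomial_deg n d)) => g;
  rewrite /form_coord enum_rankK SubK.
Qed.

(** The determinant is a polynomial in the coefficients of the form, and it
    vanishes at the forms of rank less than [N]; hence it vanishes on their
    closure. *)
Lemma border_rank_catalecticant g r :
  \det (catalecticant g) != 0 -> in_closure_rank_le d g r -> (N <= r)%N.
Proof.
move=> detg [_ clg]; rewrite leqNgt; apply/negP => rN.
have /choice[idx idxE] (p : 'I_N * 'I_N) :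
    exists i, forall h : {mpoly K[n]},
      form_coord (d:=d) h i = h@_(w p.1 + w p.2).
  exact: form_coord_monomial.
(* The determinant as a polynomial function on the space of forms. *)
pose P : {mpoly K[#|monomial_deg n d|]} := \det (\matrix_(i, j)
  ((multinomial d (w i + w j)%MM)%:R^-1 *: 'X_(idx (i, j)))).
have PE h : P.@[form_coord (d:=d) h] = \det (catalecticant h).
  rewrite /P -det_map_mx; congr (\det _); apply/matrixP => i j.
  by rewrite !mxE [LHS]mevalZ mevalXU idxE mulrC.
suff : zero_locus (set1 P) (form_coord (d:=d) g).
  by move=> /(_ P erefl); rewrite PE => /eqP; rewrite (negbTE detg).
apply: clg; split; first by exists (set1 P).
move=> _ [h [_ [k kr [/mxrank_catalecticant rk_h _]]] <-] _ ->; rewrite PE.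
apply/eqP; apply: contraTT rN => det_h; rewrite -leqNgt.
have : row_free (catalecticant h) by rewrite row_free_unit unitmxE unitfE.
by rewrite /row_free => /eqP <-; apply: leq_trans kr.
Qed.

End Catalecticant.

(** The minor indexed by squarefree monomials is diagonal at [q_n ^ s]. *)
Lemma border_rank_quadric_exp (K : numFieldType) (n s r : nat) :
  in_closure_rank_le (2 * s) (quadric K n ^+ s) r -> ('C(n, s) <= r)%N.
Proof.
pose D := [set A : {set 'I_n} | #|A| == s].
pose w (i : 'I_#|D|) := (\sum_(k in enum_val i) U_(k))%MM.
have wE i k : w i k = (k \in enum_val i).
  rewrite /w mnm_sumE big_mkcond (bigD1 k) //= big1 => [|j jk].
    by rewrite mnm1E eqxx addn0; case: (k \in _).
  by case: ifP => // _; rewrite mnm1E (negbTE jk).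
have deg_w i : mdeg (w i) = s.
  rewrite mdeg_sum (eq_bigr (fun=> 1%N)) => [|k _]; last exact: mdeg1.
  by rewrite sum1_card; apply/eqP; have := enum_valP i; rewrite inE.
have deg_ww i j : mdeg (w i + w j)%MM = (2 * s)%N.
  by rewrite mdegD !deg_w mul2n addnn.
have <- : #|D| = 'C(n, s) by rewrite card_draws card_ord.
apply: (border_rank_catalecticant deg_ww).
have diag i j : i != j -> catalecticant (2 * s) w (quadric K n ^+ s) i j = 0.
  move=> ij; rewrite mxE mcoeff_quadric_exp (_ : #|_| = 0%N) ?mul0r //.
  apply: eq_card0 => f; rewrite !inE; apply: contra_neqF ij => /eqP fE.
  (* An exponent of the product is odd if [k] lies in exactly one of the sets. *)
  apply: enum_val_inj; apply/setP => k.
  move: (congr1 (fun m : 'X_{1..n} => odd (m k)) fE).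
  rewrite /= mnm_sumE (eq_bigr _ (fun x _ => mulmnE U_(f x) 2 k)) -big_distrl /=.
  by rewrite mnmDE !wE muln2 odd_double oddD; do 2!case: (k \in _).
rewrite det_trig; last first.
  by apply/is_trig_mxP => i j ij; rewrite diag // neq_ltn ij.
apply/prodf_neq0 => i _; rewrite mxE mulf_neq0 ?invr_eq0 ?multinomial_neq0 //.
(* An enumeration of the set [enum_val i] shows that its squared monomial occurs
   in the expansion of the power. *)
have [f fE] := mnm_sum_of_variables (deg_w i).
rewrite mcoeff_quadric_exp pnatr_eq0 -lt0n; apply/card_gt0P.
exists (finfun f); rewrite inE fE -big_split /=; apply/eqP.
by apply: eq_bigr => k _; rewrite ffunE.
Qed.

(** * Upper bound: polarizing the expansion *)

Section UpperBound.
Variables (K : numClosedFieldType) (n : nat).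

Lemma sum_of_scaled_powers d (I : finType) (c : I -> K)
    (l : I -> {mpoly K[n]}) : (0 < d)%N -> (forall i, l i \is 1.-homog) ->
  sum_of_powers d (\sum_i c i *: l i ^+ d) #|I|.
Proof.
move=> d0 hl; exists (fun j => d.-root (c (enum_val j)) *: l (enum_val j)).
split=> [j|]; first exact/dhomogZ/hl.
rewrite (reindex (@enum_val I predT)) /=; last exact/onW_bij/enum_val_bij.
by apply: eq_bigr => j _; rewrite exprZn rootCK.
Qed.

(** Each term of the expansion is a product over [J], where the pair of [k] and
    a boolean stands for one of the two factors of the [k]-th square. *)
Lemma quadric_exp_sum_of_powers s : (0 < s)%N ->
  sum_of_powers (2 * s) (quadric K n ^+ s) (n ^ s * 2 ^ (2 * s)).
Proof.
move=> s0; pose J : finType := ('I_s * bool)%type.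
have cJ : #|J| = (2 * s)%N by rewrite card_prod card_ord card_bool mulnC.
pose c (p : {ffun 'I_s -> 'I_n} * {set J}) : K :=
  ((2 * s)`!)%:R^-1 * (-1) ^+ #|~: p.2|.
pose l (p : {ffun 'I_s -> 'I_n} * {set J}) : {mpoly K[n]} :=
  \sum_(j in p.2) 'X_(p.1 j.1).
have -> : quadric K n ^+ s = \sum_p c p *: l p ^+ (2 * s).
  rewrite -[s in LHS]card_ord -prodr_const bigA_distr_bigA /=.
  rewrite -(pair_bigA _ (fun f S => c (f, S) *: l (f, S) ^+ (2 * s))) /=.
  apply: eq_bigr => f _.
  transitivity (\prod_(j : J) ('X_(f j.1) : {mpoly K[n]})).
    rewrite -(pair_bigA _ (fun i (b : bool) => 'X_(f i) : {mpoly K[n]})) /=.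
    by apply: eq_bigr => i _; rewrite prodr_const card_bool.
  have fact0 : ((2 * s)`!)%:R != 0 :> K by rewrite pnatr_eq0 -lt0n fact_gt0.
  apply: (scalerI fact0); rewrite scaler_nat -[LHS]mulr_natl -cJ -polarization.
  rewrite scaler_sumr; apply: eq_bigr => S _.
  rewrite /c /l /= scalerA mulrA cJ divff // mul1r.
  by rewrite -mul_mpolyC rmorphXn rmorphN1.
have -> : (n ^ s * 2 ^ (2 * s))%N = #|{: {ffun 'I_s -> 'I_n} * {set J}}|.
  rewrite card_prod card_ffun !card_ord -cJ -cardsT -card_powerset.
  by rewrite powersetT cardsT.
apply: sum_of_scaled_powers => [|p]; first by rewrite muln_gt0.
by apply: rpred_sum => j _; rewrite dhomogX /= mdeg1.
Qed.

End UpperBound.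

(** * Existence and comparison of the two ranks *)

Lemma ex_is_least (P : set nat) m : P m -> exists r, is_least P r.
Proof.
move=> Pm; have exP : exists k, `[< P k >] by exists m; apply/asboolP.
case: (ex_minnP exP) => r /asboolP Pr minr; exists r; split=> // k Pk.
exact/minr/asboolP.
Qed.

Lemma rkP (K : fieldType) (n d : nat) (f : {mpoly K[n]}) m :
  sum_of_powers d f m -> is_rank d f (rk d f).
Proof. by move=> /ex_is_least ex; apply: xgetPex ex. Qed.

(** A form belongs to the set of forms of rank at most its own rank, so the
    border rank exists and does not exceed the rank. *)
Lemma brkP (K : fieldType) (n d : nat) (f : {mpoly K[n]}) m :
  f \is d.-homog -> sum_of_powers d f m ->
  in_closure_rank_le d f (brk d f) /\ (brk d f <= rk d f)%N.
Proof.
move=> hf /rkP rkf.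
have inc : in_closure_rank_le d f (rk d f).
  split=> // Z [_ sub]; apply: sub; exists f => //.
  by split=> //; exists (rk d f).
have [] : is_border_rank d f (brk d f) by apply: xgetPex (ex_is_least inc).
by move=> ? /(_ _ inc).
Qed.

Lemma quadric_exp_homog (K : fieldType) n s :
  quadric K n ^+ s \is (2 * s).-homog.
Proof.
apply: dhomogMn; apply: rpred_sum => i _.
suff /(dhomogMn 2) : ('X_i : {mpoly K[n]}) \is 1.-homog by rewrite mul1n.
by rewrite dhomogX /= mdeg1.
Qed.

(** * Asymptotics *)

(** Each of the [s] factors of the falling factorial is at least [n - s], which
    is at least [n / 2]. *)
Lemma bin_lower_bound n s : (2 * s <= n)%N ->
  (n ^ s <= 2 ^ s * s`! * 'C(n, s))%N.
Proof.
have [->|s_gt0 sn] := posnP s; first by rewrite bin0.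
have ffact_ge k : (k <= s -> (n - s) ^ k <= n ^_ k)%N.
  elim: k => // k IH ks; rewrite ffactnSr expnSr.
  by apply: leq_mul; [apply/IH/ltnW | apply/leq_sub2l/ltnW].
rewrite -mulnA [(s`! * _)%N]mulnC bin_ffact.
apply: leq_trans (leq_mul (leqnn _) (ffact_ge s (leqnn s))).
rewrite -expnMn leq_exp2r // mulnBr [(2 * n)%N]mul2n -addnn.
by rewrite -addnBA // leq_addr.
Qed.

Local Open Scope classical_set_scope.

Lemma ln_natr_cvgy (R : realType) : ln (n%:R : R) @[n --> \oo] --> +oo.
Proof.
apply/cvgryPge => A; near=> n.
have An : expR A <= n%:R by near: n; exact: nbhs_infty_ger.
by rewrite -[A]expRK ler_ln // posrE ?(lt_le_trans (expR_gt0 A) An) ?expR_gt0.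
Unshelve. all: by end_near. Qed.

(** The quotient [ln (u n) / ln n] lies between [s - ln a / ln n] and
    [s + ln b / ln n]. *)
Lemma cvg_logb (R : realType) (u : nat -> nat) (s a b : nat) :
  (\forall n \near \oo, (n ^ s <= a * u n)%N /\ (u n <= b * n ^ s)%N) ->
  logb (n%:R : R) (u n)%:R @[n --> \oo] --> (s%:R : R).
Proof.
move=> bounds.
have ln_pos : \forall n \near \oo, 0 < ln (n%:R : R).
  by near=> n; rewrite ln_gt0 // ltr1n; near: n; exact: nbhs_infty_ge.
have inv_ln0 := (gtr0_cvgV0 ln_pos).2 (@ln_natr_cvgy R) _.
have ln_inv0 (c : R) : s%:R + c * (ln (n%:R : R))^-1 @[n --> \oo] --> (s%:R : R).
  rewrite -[X in _ --> X]addr0 -(mulr0 c).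
  apply: cvgD; first exact: cvg_cst.
  by apply: cvgM; [exact: cvg_cst | exact: inv_ln0].
apply: (squeeze_cvgr _ (ln_inv0 (- ln a%:R)) (ln_inv0 (ln b%:R))).
near=> n.
have n1 : (1 < n)%N by near: n; exact: nbhs_infty_ge.
have [lb ub] : (n ^ s <= a * u n)%N /\ (u n <= b * n ^ s)%N by near: n.
have ns0 : (0 < n ^ s)%N by rewrite expn_gt0 (ltnW n1).
have /andP[a0 u0] : (0 < a)%N && (0 < u n)%N.
  by rewrite -muln_gt0 (leq_trans ns0).
have b0 : (0 < b)%N by move: (leq_trans u0 ub); rewrite muln_gt0 => /andP[].
have pos k : (0 < k)%N -> (k%:R : R) \is Num.pos by rewrite posrE ltr0n.
have n0 := ltnW n1.
have lnn : 0 < ln (n%:R : R) by rewrite ln_gt0 // ltr1n.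
have ln_ns : ln ((n ^ s)%:R : R) = s%:R * ln n%:R.
  by rewrite natrX lnXn ?ltr0n // mulr_natl.
have e c : s%:R + c * (ln n%:R)^-1 = (s%:R * ln n%:R + c) / ln n%:R :> R.
  by rewrite mulrDl mulfK // gt_eqF.
rewrite /logb !e !ler_pM2r ?invr_gt0 // lerBlDl -ln_ns.
rewrite -!lnM ?pos // -!natrM.
rewrite !ler_ln ?pos ?ler_nat ?muln_gt0 ?a0 ?b0 ?u0 ?ns0 //.
by rewrite lb mulnC.
Unshelve. all: by end_near. Qed.

Unset Implicit Arguments.

Theorem corollary1p6 (R : realType) (s : nat) (hs : (0 < s)%N) :
  (logb (n%:R : R) (rk (2 * s) (quadric R[i] n ^+ s))%:R
     @[n --> \oo] --> (s%:R : R))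
  /\
  (logb (n%:R : R) (brk (2 * s) (quadric R[i] n ^+ s))%:R
     @[n --> \oo] --> (s%:R : R)).
Proof.
have bounds n : (2 * s <= n)%N ->
    [/\ n ^ s <= 2 ^ s * s`! * brk (2 * s) (quadric R[i] n ^+ s),
        brk (2 * s) (quadric R[i] n ^+ s) <= rk (2 * s) (quadric R[i] n ^+ s)
      & rk (2 * s) (quadric R[i] n ^+ s) <= 2 ^ (2 * s) * n ^ s]%N.
  move=> sn; have sum := quadric_exp_sum_of_powers R[i] n hs.
  have [brkq brk_rk] := brkP (quadric_exp_homog _ _ _) sum.
  have [_ rk_min] := rkP sum.
  split=> //; last by rewrite [leqRHS]mulnC; apply: rk_min.
  apply: leq_trans (bin_lower_bound sn) _; rewrite leq_mul2l.
  by rewrite (border_rank_quadric_exp brkq) orbT.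
split; apply: (@cvg_logb _ _ _ (2 ^ s * s`!) (2 ^ (2 * s)));
  near=> n; have [] := bounds n; try by near: n; exact: nbhs_infty_ge.
  move=> lb le ub; split=> //; apply: leq_trans lb _.
  by rewrite leq_mul2l le orbT.
by move=> lb le ub; split=> //; apply: leq_trans ub.
Unshelve. all: by end_near. Qed.
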